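(* For every $n \ge 1$ and every $S \subseteq [n-1]$, the number $\beta_{\Pi^B_n}(S)$ is equal to the number of elements $\sigma$ (counted with multiplicity) of the multiset $\mathcal{B}_n$ with descent set $\mathrm{Des}(\sigma)$ equal to $n-S := \{n-x : x \in S\}$. In particular, $$h_{\Pi^B_n}(x) \ = \ \sum_{\sigma \in \mathcal{B}_n} x^{\mathrm{des}(\sigma)}$$ for every $n \ge 1$.
   Context: Write $[m]=\{1,\dots,m\}$ (with $[0]=\varnothing$). $\Pi^B_n$ is the set of all set partitions $\pi$ of $\{-n,-n+1,\dots,n\}$ such that (i) $B \in \pi$ implies $-B \in \pi$, and (ii) if $\{i,-i\} \subseteq B$ for some $i \in [n]$ and some block $B \in \pi$, then $0 \in B$. It is ordered by $\pi \preceq \sigma$ if every block of $\pi$ is contained in a block of $\sigma$; it is a graded lattice of rank $n$ with minimum the partition into singletons. For a finite graded poset $\mathcal{L}$ of rank $r$ with minimum $\hat 0$, maximum $\hat 1$ and rank function $\rho$, and for $S \subseteq [r-1]$, let $\alpha_{\mathcal{L}}(S)$ be the number of maximal chains of the subposet $\{t \in \mathcal{L} : \rho(t) \in S\} \cup \{\hat 0,\hat 1\}$, and let $\beta_{\mathcal{L}}(S) = \sum_{T \subseteq S} (-1)^{|S \setminus T|} \alpha_{\mathcal{L}}(T)$. For a finite poset $\mathcal{L}$, $h_{\mathcal{L}}(x) = (1-x)^N p_{\mathcal{L}}\left(\frac{x}{1-x}\right)$, where $p_{\mathcal{L}}(x) = \sum_{k\ge 0} c_k(\mathcal{L}) x^k$,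 $c_k(\mathcal{L})$ is the number of $k$-element chains of $\mathcal{L}$, and $N$ is the largest cardinality of a chain in $\mathcal{L}$. $\mathcal{B}_n$ is the multiset $N_1 \times N_2 \times \cdots \times N_n$ of words $\sigma = (\sigma_1,\dots,\sigma_n)$, where $N_k$ is the multiset in which each $i \in [k]$ appears exactly $2k-2i+1$ times (so $N_1=\{1\}$, $N_2=\{1,1,1,2\}$, $N_3=\{1,1,1,1,1,2,2,2,3\}$, etc.); multiplicities multiply in the product, and sums over $\mathcal{B}_n$ are with multiplicity. For $\sigma \in \mathcal{B}_n$, $\mathrm{Des}(\sigma) = \{i \in [n-1] : \sigma_i \ge \sigma_{i+1}\}$ and $\mathrm{des}(\sigma) = |\mathrm{Des}(\sigma)|$. *)

(* Defs.v *)
From HB Require Import structures.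
From mathcomp Require Import all_boot all_order all_algebra finmap.

Set Implicit Arguments.
Unset Strict Implicit.
Unset Printing Implicit Defensive.

Import Order.TTheory GRing.Theory Num.Theory.
Local Open Scope fset_scope.
Local Open Scope ring_scope.

Definition interval1 (m : nat) : {fset nat} := [fset i in iota 1 m].

Section FinitePosets.
Context {d : Order.disp_t}.

Definition is_chain {L : finPOrderType d} (C : {set L}) : bool :=
  [forall x in C, forall y in C, (x >=< y)%O].

(* The empty chain is included, so [nb_chains L 0 = 1]. *)
Definition nb_chains (L : finPOrderType d) (k : nat) : nat :=
  #|[set C : {set L} | is_chain C & #|C| == k]|.

Definition max_chain_card (L : finPOrderType d) : nat :=
  \max_(C : {set L} | is_chain C) #|C|.

(* All nonzero terms have [k <= #|L|]. *)
Definition chain_poly (L : finPOrderType d) : {poly int} :=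
  \poly_(k < #|L|.+1) (nb_chains L k)%:Z.

(* The h-polynomial, as the rational function (1 - x)^N p(x / (1 - x)). *)
Definition h_poly (L : finPOrderType d) : {fraction {poly int}} :=
  let x : {fraction {poly int}} := FracField.tofrac 'X in
  (1 - x) ^+ max_chain_card L * (map_poly intr (chain_poly L)).[x / (1 - x)].

(* Length of a longest chain with all elements below [t]; this is the rank
   function when [L] is graded. *)
Definition rank {L : finPOrderType d} (t : L) : nat :=
  (\max_(C : {set L} | is_chain C && [forall u in C, (u <= t)%O]) #|C|).-1.

Definition rank_selected (L : finTBPOrderType d) (S : {fset nat}) : {set L} :=
  ([set t : L | rank t \in S] :|: [set Order.bottom; Order.top])%SET.

Definition alpha (L : finTBPOrderType d) (S : {fset nat}) : nat :=
  #|[set C : {set L} |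
      maxset (fun D => is_chain D && (D \subset rank_selected L S)) C]|.

Definition beta (L : finTBPOrderType d) (S : {fset nat}) : int :=
  \sum_(T <- fpowerset S) (-1) ^+ #|` S `\` T| * (alpha L T)%:Z.

End FinitePosets.

(* The set {-n, ..., n}, where [i : 'I_(2n+1)] stands for the integer i - n;
   negation is then [rev_ord]. *)
Notation signed n := 'I_n.*2.+1.

Definition szval {n} (i : signed n) : int := i%:Z - n%:Z.
Definition szero {n} : signed n := inord n.
Definition sopp {n} (i : signed n) : signed n := rev_ord i.

Lemma szval_inj n : injective (@szval n).
Proof. by move=> i j /addIr [] /val_inj. Qed.

Lemma szval_range n (z : int) :
  reflect (exists i : signed n, szval i = z) (- n%:Z <= z <= n%:Z).
Proof.
apply: (iffP idP) => [/andP[h1 h2]|[i <-]]; last first.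
  have hi : ((i : nat) <= n + n)%N by rewrite addnn -ltnS.
  by rewrite /szval lerBrDr addNr lerBlDr -PoszD !lez_nat leq0n hi.
have h0 : 0 <= z + n%:Z by rewrite -lerBlDr sub0r.
have hlt : (absz (z + n%:Z)%R < n.*2.+1)%N.
  by rewrite ltnS -lez_nat gez0_abs // -addnn PoszD lerD2r.
by exists (Ordinal hlt); rewrite /szval /= gez0_abs // addrK.
Qed.

Lemma szval0 n : szval (@szero n) = 0.
Proof. by rewrite /szval /szero inordK ?subrr // ltnS -addnn leq_addr. Qed.

Lemma szvalN n (i : signed n) : szval (sopp i) = - szval i.
Proof.
have hi : ((i : nat) <= n.*2)%N by rewrite -ltnS.
rewrite /szval /sopp /= subSS; move: (i : nat) hi => k hk.
by rewrite -subzn // -addnn PoszD opprB addrAC addrK.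
Qed.

Lemma sopp_inj n : injective (@sopp n).
Proof. exact: rev_ord_inj. Qed.

Definition is_typeB_partition n (P : {set {set signed n}}) : bool :=
  [&& partition P [set: signed n],
      [forall B in P, sopp @: B \in P] &
      [forall B in P, forall i : signed n,
         (0 < szval i) && ([set i; sopp i]%SET \subset B) ==> (szero \in B)]].

Record typeB_partition (n : nat) := TypeBPartition {
  blocks : {set {set signed n}};
  blocksP : is_typeB_partition blocks }.

HB.instance Definition _ n := [isSub for @blocks n].
HB.instance Definition _ n := [Finite of typeB_partition n by <:].

Section Refinement.
Variable n : nat.
Implicit Types P Q R : typeB_partition n.

Definition refines P Q : bool :=
  [forall B in blocks P, exists C in blocks Q, B \subset C].

Lemma refinesP P Q :
  reflect (forall B, B \in blocks P -> exists2 C, C \in blocks Q & B \subset C)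
          (refines P Q).
Proof.
apply: (iffP forall_inP) => h B /h; first by move/exists_inP.
by move=> ?; apply/exists_inP.
Qed.

Lemma refines_refl : reflexive refines.
Proof. by move=> P; apply/refinesP => B PB; exists B. Qed.

Lemma refines_trans : transitive refines.
Proof.
move=> Q P R /refinesP PQ /refinesP QR; apply/refinesP => B /PQ [C /QR [D RD CD] BC].
by exists D => //; apply: subset_trans CD.
Qed.

Lemma blocks_partition P : partition (blocks P) [set: signed n].
Proof. by case/and3P: (blocksP P). Qed.

Lemma refines_sub P Q : refines P Q -> refines Q P -> blocks P \subset blocks Q.
Proof.
move=> /refinesP PQ /refinesP QP; apply/subsetP => B PB.
have [C QC BC] := PQ B PB; have [D PD CD] := QP C QC.
have /and3P[_ /trivIsetP tP P0] := blocks_partition P.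
have BD : B = D.
  apply/eqP; apply: contraT => /(tP _ _ PB PD) /disjoint_setI0.
  have /setIidPl -> := subset_trans BC CD.
  by move=> B0; rewrite -B0 PB in P0.
by suff -> : B = C by []; apply/eqP; rewrite eqEsubset BC /= BD CD.
Qed.

Lemma refines_anti : antisymmetric refines.
Proof.
move=> P Q /andP[PQ QP]; apply: val_inj; apply/eqP.
by rewrite eqEsubset !refines_sub.
Qed.

Fact bottom_subproof :
  is_typeB_partition [set [set i]%SET | i in [set: signed n]]%SET.
Proof.
apply/and3P; split.
- apply/and3P; split.
  + rewrite eqEsubset subsetT; apply/subsetP => i _.
    by apply/bigcupP; exists [set i]%SET; rewrite ?set11 ?imset_f ?inE.
  + apply/trivIsetP => _ _ /imsetP[i _ ->] /imsetP[j _ ->] nij.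
    by rewrite disjoints1 inE; apply: contraNN nij => /eqP ->.
  + by apply/imsetP => -[i _ /setP/(_ i)]; rewrite !inE eqxx.
- apply/forall_inP => _ /imsetP[i _ ->].
  by rewrite imset_set1 imset_f ?inE.
- apply/forall_inP => _ /imsetP[j _ ->]; apply/forallP => i.
  apply/implyP; rewrite subUset !sub1set !inE => /and3P[i0 /eqP ij /eqP nij].
  by have := i0; rewrite -oppr_lt0 -szvalN nij -ij ltNge (ltW i0).
Qed.

Fact top_subproof : is_typeB_partition [set [set: signed n]]%SET.
Proof.
apply/and3P; split.
- apply/and3P; split.
  + by rewrite /cover big_set1.
  + by apply/trivIsetP => A B; rewrite !inE => /eqP-> /eqP->; rewrite eqxx.
  + by rewrite inE; apply/eqP => /setP/(_ szero); rewrite !inE.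
- apply/forall_inP => B; rewrite !inE => /eqP ->.
  rewrite eqEsubset subsetT; apply/subsetP => i _.
  by apply/imsetP; exists (sopp i); rewrite ?inE // /sopp rev_ordK.
- apply/forall_inP => B; rewrite inE => /eqP ->; apply/forallP => i.
  by rewrite !inE implybT.
Qed.

Definition finest : typeB_partition n := TypeBPartition bottom_subproof.
Definition coarsest : typeB_partition n := TypeBPartition top_subproof.

Lemma finest_refines P : refines finest P.
Proof.
apply/refinesP => _ /imsetP[i _ ->].
have /and3P[/eqP cP _ _] := blocks_partition P.
have : i \in cover (blocks P) by rewrite cP inE.
by case/bigcupP => B PB iB; exists B; rewrite ?sub1set.
Qed.

Lemma refines_coarsest P : refines P coarsest.
Proof.
by apply/refinesP => B _; exists [set: signed n]; rewrite ?inE ?subsetT.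
Qed.

End Refinement.

Fact refinement_display : Order.disp_t. Proof. exact: Order.Disp tt tt. Qed.

HB.instance Definition _ n :=
  Order.Le_isPOrder.Build refinement_display (typeB_partition n)
    (@refines_refl n) (@refines_anti n) (@refines_trans n).
HB.instance Definition _ n :=
  Order.hasBottom.Build refinement_display (typeB_partition n)
    (@finest_refines n).
HB.instance Definition _ n :=
  Order.hasTop.Build refinement_display (typeB_partition n)
    (@refines_coarsest n).

Definition PiB (n : nat) : finTBPOrderType refinement_display :=
  typeB_partition n.

(* Finite multisets are represented by sequences, up to reordering. *)
Definition Nmset (k : nat) : seq nat :=
  flatten [seq nseq (2 * k - 2 * i + 1) i | i <- iota 1 k].

Fixpoint Bmset (n : nat) : seq (seq nat) :=
  if n is m.+1 then [seq rcons w i | w <- Bmset m, i <- Nmset m.+1]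
  else [:: [::]].

(* The letters are indexed from 1. *)
Definition letter (w : seq nat) (i : nat) : nat := nth 0%N w i.-1.

Definition Des (w : seq nat) : {fset nat} :=
  [fset i in interval1 (size w).-1 | (letter w i.+1 <= letter w i)%N].

Definition des (w : seq nat) : nat := #|` Des w|.

(* Main.v *)
(* Let m(pi) be the number of pairs {B, -B} of nonzero blocks of pi, so that
   n - m is the rank function.  For every q, odd maps from {-n, ..., n} to
   {-q, ..., q} that are constant on the blocks of pi number (2q+1)^m(pi);
   sorting them by their kernel, a type B partition above pi, gives
     (2q+1)^m(pi) = sum_k N(pi, k) 2^k q(q-1)...(q-k+1),
   where N(pi, k) counts the elements sigma above pi with m(sigma) = k.  Linear
   independence of the right-hand polynomials yields N(pi, k) = W(m(pi), k) with
   W(m, k) = h_{m-k}(1, 3, ..., 2k+1).  Hence the chains above pi whose set of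
   values of m is K are counted by W(m(pi), k1) W(k1, k2) ... for
   K = {k1 > k2 > ...}.  The words of B_m with descent set inside K obey the same
   product formula: cut a word at the positions in K; with letters
   sigma_i = i - t_i, a strictly increasing factor after position k is a weakly
   decreasing sequence of t's in {0, ..., k}, with weight the product of the
   2 t_i + 1.  So alpha(S) counts the words with Des contained in n - S, and both
   claims follow by inclusion-exclusion. *)
Require Import Defs.
From mathcomp Require Import all_boot all_order all_algebra finmap zify ring.

Set Implicit Arguments.
Unset Strict Implicit.
Unset Printing Implicit Defensive.

Import Order.TTheory GRing.Theory Num.Theory.

Local Open Scope nat_scope.

(** * Type B Stirling numbers *)

(* The complete homogeneous symmetric polynomial of degree [d] evaluated at
   the odd numbers 2 * lo + 1, ..., 2 * hi + 1. *)
Fixpoint hom_odd (d lo hi : nat) : nat :=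
  if d is d'.+1 then \sum_(lo <= t < hi.+1) (2 * t + 1) * hom_odd d' t hi
  else 1.

(** The type B Stirling number W(m, k). The guard matters: for [k > m] truncated subtraction would
    give h_0 = 1. *)
Definition stirlingB (m k : nat) : nat :=
  if k <= m then hom_odd (m - k) 0 k else 0.

Lemma hom_oddS d lo hi : hom_odd d.+1 lo hi =
  \sum_(lo <= t < hi.+1) (2 * t + 1) * hom_odd d t hi.
Proof. by []. Qed.

Arguments hom_odd : simpl never.

Arguments stirlingB : simpl never.

Lemma hom_odd_empty d lo hi : 0 < d -> hi < lo -> hom_odd d lo hi = 0.
Proof. by case: d => // d _ h; rewrite hom_oddS big_geq. Qed.

Lemma hom_odd_diag d hi : hom_odd d hi hi = (2 * hi + 1) ^ d.
Proof. by elim: d => // d IH; rewrite hom_oddS big_nat1 IH expnS. Qed.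

(** [hom_odd] splits off the smallest variable of a monomial; here the monomials are sorted by
    whether they contain the largest variable. *)
Lemma hom_odd_recr d lo hi : lo <= hi.+1 ->
  hom_odd d.+1 lo hi.+1 =
  hom_odd d.+1 lo hi + (2 * hi.+1 + 1) * hom_odd d lo hi.+1.
Proof.
elim: d lo => [|d IH] lo hlo.
  rewrite !hom_oddS big_nat_recr //=.
rewrite hom_oddS big_nat_recr //= hom_odd_diag.
rewrite [hom_odd d.+2 lo hi]hom_oddS [hom_odd d.+1 lo hi.+1]hom_oddS.
rewrite [X in _ = _ + _ * X]big_nat_recr //= hom_odd_diag expnS.
rewrite mulnDr addnA; congr (_ + _).
rewrite big_distrr /= -big_split /=; apply: eq_big_nat => t /andP[_ ht].
rewrite IH; last by lia.
by rewrite mulnDr; congr (_ + _); rewrite mulnCA.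
Qed.

Lemma stirlingBSS m k :
  stirlingB m.+1 k.+1 = (2 * k.+1 + 1) * stirlingB m k.+1 + stirlingB m k.
Proof.
rewrite /stirlingB ltnS; case: (leqP k m) => hk; last by rewrite ifF ?muln0 //; lia.
rewrite subSS; case: ltnP => [hk'|hk'].
  by rewrite -(subnSK hk') hom_odd_recr // addnC.
have -> : m = k by lia.
by rewrite subnn muln0.
Qed.

Lemma stirlingB_m0 m : stirlingB m 0 = 1.
Proof. by rewrite /stirlingB hom_odd_diag exp1n. Qed.

Lemma stirlingB_small m k : m < k -> stirlingB m k = 0.
Proof. by rewrite /stirlingB ltnNge; case: leqP. Qed.

(** Induction on [m]: multiplying the basis element [P k] by 2q + 1 acts on coefficients as the
    recurrence [stirlingBSS]. *)
Lemma expn_stirlingB q m N : m < N ->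
  (2 * q + 1) ^ m = \sum_(k < N) stirlingB m k * (2 ^ k * q ^_ k).
Proof.
elim: m N => [|m IH] [|N] //= hN.
  by rewrite big_ord_recl /= stirlingB_m0 big1.
pose P k := 2 ^ k * q ^_ k.
(* For k <= q write 2q + 1 = (2k + 1) + 2(q - k); for k > q both sides vanish. *)
have PS k : (2 * q + 1) * P k = (2 * k + 1) * P k + P k.+1.
  rewrite /P expnS ffactnSr; case: (leqP k q) => [hk|hk].
    by rewrite -{1}(subnKC hk); set x := q - k; ring.
  by rewrite ffact_small // !(mul0n, muln0).
rewrite expnS (IH N.+1) ?big_distrr //=; last by lia.
under eq_bigr => k _ do rewrite mulnCA -/(P k) PS mulnDr.
rewrite big_split /= big_ord_recl [X in _ = X]big_ord_recl /= !stirlingB_m0.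
rewrite [X in _ + X = _]big_ord_recr /= [stirlingB m N]stirlingB_small // mul0n addn0.
rewrite -addnA mul1n -big_split /=; congr (_ + _).
by apply: eq_bigr => k _; rewrite /bump /= !add1n stirlingBSS -/(P _) mulnDl; ring.
Qed.

(* The polynomials 2^k q (q - 1) ... (q - k + 1) in [q] are linearly
   independent: evaluate at q = 0, 1, 2, ... in turn. *)
Lemma ffact_coef_uniq N (a b : nat -> nat) :
  (forall q, \sum_(k < N) a k * (2 ^ k * q ^_ k) =
             \sum_(k < N) b k * (2 ^ k * q ^_ k)) ->
  forall k, k < N -> a k = b k.
Proof.
move=> hab k; elim/ltn_ind: k => k IH hk.
have := hab k; rewrite (bigD1 (Ordinal hk)) //= [RHS](bigD1 (Ordinal hk)) //=.
have -> : \sum_(i < N | i != Ordinal hk) a i * (2 ^ i * k ^_ i) =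
          \sum_(i < N | i != Ordinal hk) b i * (2 ^ i * k ^_ i).
  apply: eq_bigr => i; rewrite -val_eqE /= => ik.
  case: (ltnP i k) => [hi|hi]; first by rewrite IH.
  by rewrite ffact_small ?muln0 //; lia.
move/addIn/eqP; rewrite eqn_mul2r ffactnn => /orP[|/eqP //].
by rewrite muln_eq0 expn_eq0 /= eqn0Ngt fact_gt0.
Qed.

(** * Words with prescribed descents *)

Definition descents_in (K : pred nat) (w : seq nat) : bool :=
  all (fun i => (letter w i.+1 <= letter w i) ==> K i) (iota 1 (size w).-1).

Lemma descents_in_rcons K w i : descents_in K (rcons w i) =
  descents_in K w && [|| size w == 0, last 0 w < i | K (size w)].
Proof.
rewrite /descents_in size_rcons /=.
case: (lastP w) => [|w' l]; first by [].
rewrite size_rcons -[in LHS](addn1 (size w')) iotaD all_cat /= andbT add1n last_rcons.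
congr (_ && _).
  apply: eq_in_all => j; rewrite mem_iota => hj.
  by rewrite /letter ![nth _ (rcons (rcons _ _) _) _]nth_rcons size_rcons !ifT //; lia.
rewrite /letter /= nth_rcons size_rcons ltnn eqxx.
rewrite nth_rcons size_rcons ltnSn nth_rcons ltnn eqxx.
by case: ltnP.
Qed.

Lemma eq_descents_in K K' w :
  (forall i, 0 < i < size w -> K i = K' i) ->
  descents_in K w = descents_in K' w.
Proof.
move=> h; apply: eq_in_all => i; rewrite mem_iota => hi; rewrite h //; lia.
Qed.

Lemma count_Nmset (P : pred nat) m :
  count P (Nmset m.+1) = \sum_(0 <= t < m.+1) (2 * t + 1) * P (m.+1 - t).
Proof.
rewrite /Nmset count_flatten -map_comp sumnE big_map.
rewrite -[1%N]/(1 + 0)%N iotaDl big_map.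
rewrite -[iota 0 m.+1]/(index_iota 0 m.+1) big_nat_rev /= add0n.
apply: eq_big_nat => t ht; rewrite count_nseq mulnC.
have -> : 1 + (m.+1 - t.+1) = m.+1 - t by lia.
by congr (_ * _); lia.
Qed.

Lemma count_BmsetS (P : pred (seq nat)) m :
  count P (Bmset m.+1) =
  \sum_(w <- Bmset m) \sum_(0 <= t < m.+1) (2 * t + 1) * P (rcons w (m.+1 - t)).
Proof.
rewrite /= count_flatten -map_comp sumnE big_map; apply: eq_bigr => w _ /=.
by rewrite count_map (count_Nmset (preim (rcons w) P)).
Qed.

Lemma Bmset_shape m w : w \in Bmset m -> (size w = m) * (last 0 w <= m).
Proof.
elim: m w => [|m IH] w /=; first by rewrite inE => /eqP ->.
move=> /allpairsP[[w' i] /= [/IH[sw _] hi ->]].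
rewrite size_rcons sw last_rcons; split=> //.
move: hi => /flattenP[s /mapP[j]].
by rewrite mem_iota => hj -> /nseqP[-> _]; lia.
Qed.

Definition nb_descents_in (K : pred nat) (m : nat) : nat :=
  count (descents_in K) (Bmset m).

Lemma eq_nb_descents_in K K' m : (forall i, 0 < i < m -> K i = K' i) ->
  nb_descents_in K m = nb_descents_in K' m.
Proof.
move=> h; apply: eq_in_count => w /Bmset_shape[sw _].
by apply: eq_descents_in => i; rewrite sw; apply: h.
Qed.

(** Write the last letter as m + 1 - s, of multiplicity 2s + 1. The bound on it becomes s >= t, and
    it creates no descent at position m exactly when the previous letter is at most m - s. *)
Lemma count_last_letter K m t :
  count (fun w => descents_in K w && (last 0 w + t <= m.+1)) (Bmset m.+1) =
  \sum_(t <= s < m.+1) (2 * s + 1) *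
    count (fun w => descents_in K w && [|| m == 0, last 0 w + s <= m | K m])
      (Bmset m).
Proof.
rewrite count_BmsetS (big_nat_widenl t 0) //=.
under [RHS]eq_bigr => s _ do rewrite -sum1_count big_distrr /= big_mkcond /=.
rewrite exchange_big [RHS]big_mkcond /=; apply: eq_big_nat => s /andP[_ hs].
have -> : (if t <= s then \sum_(i <- Bmset m)
    (if descents_in K i && [|| m == 0, last 0 i + s <= m | K m]
     then (2 * s + 1) * 1 else 0) else 0) =
  \sum_(i <- Bmset m) (2 * s + 1) *
    ((descents_in K i && [|| m == 0, last 0 i + s <= m | K m]) && (t <= s)).
  case: (t <= s); last by rewrite big1 // => i _; rewrite andbF muln0.
  by apply: eq_bigr => i _; rewrite andbT; case: ifP; rewrite ?muln0.
apply: eq_big_seq => w /Bmset_shape[sw lw].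
rewrite descents_in_rcons sw last_rcons; congr (_ * nat_of_bool _).
by congr (_ && [|| _, _ | _] && _); lia.
Qed.

(* Writing the letters of [[m]] as m - t makes the multiplicity in N_m equal
   to 2 t + 1, and turns the strict ascents of a word after position [k] into
   weak descents of the parameter [t]. *)
Lemma count_ascending_tail (K : pred nat) (k d t : nat) :
  (k == 0) || K k -> (forall j, k < j < k + d.+1 -> ~~ K j) ->
  count (fun w => descents_in K w && (last 0 w + t <= k + d.+1))
    (Bmset (k + d.+1)) =
  nb_descents_in K k * hom_odd d.+1 t k.
Proof.
move=> Kk; elim: d t => [|d IH] t hK; rewrite addnS count_last_letter hom_oddS.
  rewrite addn0 big_distrr; apply: eq_bigr => s _ /=.
  rewrite muln1 mulnC; congr (_ * _); apply: eq_in_count => w _.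
  by rewrite orbCA Kk orbT andbT.
have Km : K (k + d.+1) = false by apply/negbTE/hK; lia.
transitivity (\sum_(t <= s < (k + d.+1).+1)
    (2 * s + 1) * (nb_descents_in K k * hom_odd d.+1 s k)).
  apply: eq_bigr => s _; rewrite -IH; last by move=> j hj; apply: hK; lia.
  congr (_ * _); apply: eq_count => w.
  by rewrite Km orbF [in _ == 0]addnS.
(* Parameters s > k contribute nothing, since a complete homogeneous polynomial of positive degree
   in no variables is 0. *)
case: (leqP t k) => hk; last first.
  rewrite [in RHS]big_geq // muln0 big_nat_cond big1 // => s /andP[/andP[hs _] _].
  by rewrite hom_odd_empty ?muln0 //; lia.
rewrite (big_cat_nat _ (n := k.+1)) /=; [|lia|lia].
rewrite [X in _ + X = _]big_nat_cond [X in _ + X = _]big1 ?addn0.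
  by rewrite big_distrr; apply: eq_bigr => s _ /=; rewrite mulnCA.
by move=> s /andP[/andP[hs _] _]; rewrite hom_odd_empty ?muln0.
Qed.

(** Cut the word at [k]: no descent is allowed beyond it, so [count_ascending_tail] applies with t =
    0, where the bound on the last letter is vacuous. The value [k = 0] covers the case without
    allowed descents. *)
Lemma nb_descents_in_max K m k : k <= m -> (k == 0) || K k ->
  (forall j, k < j < m -> ~~ K j) ->
  nb_descents_in K m = stirlingB m k * nb_descents_in K k.
Proof.
move=> hk Kk hK; rewrite /stirlingB hk; case: (m =P k) => [->|/eqP nmk].
  by rewrite subnn mul1n.
have -> : m = k + (m - k).-1.+1 by lia.
rewrite addKn mulnC -count_ascending_tail //; last by move=> j hj; apply: hK; lia.
apply: eq_in_count => w /Bmset_shape[_ hw].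
by rewrite addn0 hw andbT.
Qed.

Lemma nb_descents_in0 K m : (forall j, 0 < j < m -> ~~ K j) ->
  nb_descents_in K m = 1.
Proof.
by move=> hK; rewrite (@nb_descents_in_max K m 0) // stirlingB_m0.
Qed.

(** * Chains in a poset graded by a corank function *)

Lemma is_chainP d (L : finPOrderType d) (C : {set L}) :
  reflect {in C &, forall x y, (x >=< y)%O} (is_chain C).
Proof.
apply: (iffP forall_inP) => [h x y Cx Cy|h x Cx].
  by have /forall_inP := h x Cx; apply.
by apply/forall_inP => y Cy; apply: h.
Qed.

Lemma is_chainS d (L : finPOrderType d) (C D : {set L}) :
  C \subset D -> is_chain D -> is_chain C.
Proof.
by move=> /subsetP CD /is_chainP h; apply/is_chainP => x y /CD Dx /CD; apply: h.
Qed.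

Lemma is_chainU1 d (L : finPOrderType d) (C : {set L}) z :
  is_chain C -> {in C, forall y, (z >=< y)%O} -> is_chain (z |: C).
Proof.
move=> /is_chainP h hz; apply/is_chainP => x y.
rewrite !inE => /predU1P[->|Cx] /predU1P[->|Cy]; last exact: h.
- exact: comparablexx.
- exact: hz.
- by rewrite comparable_sym hz.
Qed.

Section Corank.
Context {d : Order.disp_t} {L : finTBPOrderType d} (c : L -> nat).
Hypothesis c_anti : forall x y, (x < y)%O -> c y < c x.

Local Notation bot := (Order.bottom : L).
Local Notation top := (Order.top : L).
Local Notation n := (c bot).

Lemma corank_le x y : (x <= y)%O -> c y <= c x.
Proof. by rewrite le_eqVlt => /predU1P[->//|/c_anti/ltnW]. Qed.

Lemma corank_le_bottom x : c x <= n.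
Proof. exact/corank_le/le0x. Qed.

Lemma comparable_corank_le x y : (x >=< y)%O -> c y <= c x -> (x <= y)%O.
Proof.
move=> hxy cyx; case: (comparable_leP hxy) => // /c_anti.
by rewrite ltnNge cyx.
Qed.

Lemma comparable_corank_inj x y : (x >=< y)%O -> c x = c y -> x = y.
Proof.
move=> hxy cxy; apply/le_anti.
by rewrite !comparable_corank_le ?cxy // comparable_sym.
Qed.

Definition corank_ord (x : L) : 'I_n.+1 := inord (c x).

Lemma corank_ordE x : corank_ord x = c x :> nat.
Proof. by rewrite inordK // ltnS corank_le_bottom. Qed.

Lemma chain_corank_inj C : is_chain C -> {in C &, injective corank_ord}.
Proof.
move=> /is_chainP h x y Cx Cy /(congr1 val) /=; rewrite !corank_ordE.
by apply: comparable_corank_inj; apply: h.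
Qed.

Lemma card_chain_coranks C : is_chain C -> #|corank_ord @: C| = #|C|.
Proof. by move/chain_corank_inj/card_in_imset. Qed.

Definition chains_above (x : L) (K : {set 'I_n.+1}) : {set {set L}} :=
  [set C | [&& is_chain C, [forall y in C, (x <= y)%O] & corank_ord @: C == K]].

Lemma chains_above0 x : chains_above x set0 = [set set0].
Proof.
apply/setP => C; rewrite !inE imset_eq0; apply/and3P/idP => [[]//|/eqP->].
by split=> //; [apply/is_chainP => ? ?; rewrite inE|apply/forall_inP => y; rewrite inE].
Qed.

(** The largest corank [k] of a chain belongs to its least element t; removing t leaves a chain
    above t with the remaining coranks. *)
Lemma card_chains_above_max x (K : {set 'I_n.+1}) k :
  k \in K -> (forall j, j \in K -> j <= k) ->
  #|chains_above x K| =
  \sum_(t : L | (x <= t)%O && (c t == k)) #|chains_above t (K :\ k)|.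
Proof.
move=> Kk kmax.
pose A := [set p : L * {set L} |
  (x <= p.1)%O && (c p.1 == k) && (p.2 \in chains_above p.1 (K :\ k))].
have Anotin p : p \in A -> p.1 \notin p.2.
  rewrite !inE => /andP[/andP[_ ck] /and3P[_ _ /eqP hK]].
  apply/negP => p12; have := imset_f corank_ord p12.
  by rewrite hK !inE -val_eqE /= corank_ordE ck.
transitivity #|[set p.1 |: p.2 | p in A]|; last first.
  rewrite card_in_imset; last first.
    move=> [t C] [u D] Ap Aq /= E.
    have tu : t = u.
      have : t \in u |: D by rewrite -E setU11.
      rewrite !inE => /predU1P[//|Dt]; move: Ap Aq.
      rewrite !inE /= => /andP[/andP[_ /eqP ck] _] /andP[_ /and3P[_ _ /eqP hK]].
      have := imset_f corank_ord Dt.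
      by rewrite hK !inE -val_eqE /= corank_ordE ck eqxx.
    rewrite -tu in Aq E *; congr (_, _).
    have /= tC := Anotin _ Ap; have /= tD := Anotin _ Aq.
    by rewrite -(setU1K tC) E (setU1K tD).
  rewrite -sum1_card; under [RHS]eq_bigr => t _ do rewrite -sum1_card.
  by rewrite pair_big_dep /=; apply: eq_bigl => p; rewrite inE.
apply: eq_card => C; apply/idP/imsetP => [|[[t D]]]; last first.
  rewrite !inE /= => /andP[/andP[xt /eqP ck] /and3P[chD /forall_inP tD /eqP KD]] ->.
  apply/and3P; split.
  - by apply: is_chainU1 => // y /tD /le_comparable.
  - apply/forall_inP => y; rewrite !inE => /predU1P[->//|/tD].
    exact: le_trans.
  rewrite imsetU1 KD; have -> : corank_ord t = k by apply: val_inj; rewrite /= corank_ordE.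
  by rewrite setD1K.
rewrite inE => /and3P[chC /forall_inP xC /eqP KC].
have /imsetP[t Ct kt] : k \in corank_ord @: C by rewrite KC.
have ck : c t = k by rewrite kt corank_ordE.
exists (t, C :\ t); last by rewrite /= setD1K.
rewrite !inE /= xC // ck eqxx /=; apply/and3P; split.
- by apply: is_chainS chC; apply: subD1set.
- apply/forall_inP => y; rewrite !inE => /andP[_ Cy].
  apply: comparable_corank_le; first by move/is_chainP: chC; apply.
  by rewrite ck -corank_ordE kmax // -KC imset_f.
apply/eqP/setP => j; rewrite !inE -KC; apply/imsetP/andP.
  move=> [y]; rewrite !inE => /andP[yt Cy] ->; split; last exact: imset_f.
  by apply: contraNneq yt => E; apply/eqP/(chain_corank_inj chC); rewrite // E.
move=> [jk /imsetP[y Cy jy]]; exists y => //; rewrite !inE Cy andbT.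
by apply: contraNneq jk => yt; rewrite jy yt -kt.
Qed.

(** Induction on the size of [K]. With k = max K, choosing the least element of the chain gives the
    factor W(c x, k), and cutting the words at k gives the same factor. *)
Lemma card_chains_above x (K : {set 'I_n.+1}) :
  (forall x k, #|[set y | (x <= y)%O & c y == k]| = stirlingB (c x) k) ->
  (forall k, k \in K -> k <= c x) ->
  #|chains_above x K| = nb_descents_in (fun i => inord i \in K) (c x).
Proof.
move=> c_count; move: {2}#|K| (erefl #|K|) => m; elim: m K x => [|m IH] K x cK hK.
  move/eqP: cK; rewrite cards_eq0 => /eqP ->; rewrite chains_above0 cards1.
  by rewrite nb_descents_in0 // => j _; rewrite inE.
have /card_gt0P[k0 Kk0] : 0 < #|K| by rewrite cK.
case: (@arg_maxnP _ k0 [in K] val Kk0) => k /= Kk kmax.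
rewrite (card_chains_above_max _ Kk kmax).
(* [inord] is faithful only up to [n] and sends larger numbers to 0, hence the bound on j; coranks
   never exceed [n]. *)
have nK j : k < j <= n -> inord j \notin K.
  by move=> /andP[kj jn]; apply/negP => /kmax /=; rewrite inordK // leqNgt kj.
rewrite (@nb_descents_in_max _ (c x) k) ?hK ?inord_val ?Kk ?orbT //; last first.
  by move=> j hj; apply: nK; have := corank_le_bottom x; lia.
rewrite -c_count -sum1_card big_distrl /=.
apply: eq_big => [t|t /andP[_ /eqP ct]]; first by rewrite inE.
rewrite mul1n IH; first 1 last.
- by apply/eqP; rewrite -eqSS -cK (cardsD1 k K) Kk.
- by move=> j; rewrite !inE ct => /andP[_]; apply: kmax.
rewrite ct; apply: eq_nb_descents_in => i /andP[_ ik].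
rewrite !inE (_ : (_ == k) = false) //; apply/negbTE.
by rewrite -val_eqE /= inordK; have := ltn_ord k; lia.
Qed.

(** * Ranks and maximal chains in the graded case *)

Hypothesis c_top : c top = 0.
Hypothesis c_cover : forall x y, (x < y)%O ->
  exists2 z, (x < z <= y)%O & c x = (c z).+1.

(** [c_cover] climbs from x towards y, lowering the corank by one each time, so no value in between
    is skipped. *)
Lemma corank_interpolate x y k : (x <= y)%O -> c y <= k <= c x ->
  exists2 z, (x <= z <= y)%O & c z = k.
Proof.
move: {2}(c x - k) (erefl (c x - k)) => m; elim: m x => [|m IH] x hm xy /andP[yk kx].
  by exists x; rewrite ?lexx //; lia.
have : (x < y)%O.
  by rewrite lt_neqAle xy andbT; apply/eqP => E; rewrite E in hm; lia.
case/c_cover => z /andP[xz zy] cxz.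
have [||u /andP[zu uy] cu] := IH z _ zy; [lia|lia|].
by exists u; rewrite // (le_trans (ltW xz)).
Qed.

Lemma corank_eq_top x : (c x == 0) = (x == top).
Proof.
apply/eqP/eqP => [cx|->//]; apply: comparable_corank_inj; last by rewrite cx.
exact/le_comparable/lex1.
Qed.

Lemma corank_eq_bottom x : (c x == n) = (x == bot).
Proof.
apply/eqP/eqP => [cx|->//]; apply/esym/comparable_corank_inj; last by rewrite cx.
exact/le_comparable/le0x.
Qed.

(** Upper bound: [c] is injective on a chain and takes values from [c t] to [n]. Lower bound: a
    chain is built below t, one corank at a time. *)
Lemma max_chain_card_le t :
  \max_(C : {set L} | is_chain C && [forall u in C, (u <= t)%O]) #|C| =
  (n - c t).+1.
Proof.
apply/eqP; rewrite eqn_leq; apply/andP; split.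
  apply/bigmax_leqP => C /andP[chC /forall_inP Ct].
  rewrite cardE -(size_map c) -(size_iota (c t) (n - c t).+1); apply: uniq_leq_size.
    rewrite map_inj_in_uniq ?enum_uniq // => x y; rewrite !mem_enum => Cx Cy.
    by apply: comparable_corank_inj; move/is_chainP: chC; apply.
  move=> k /mapP[y]; rewrite mem_enum => Cy ->; rewrite mem_iota.
  by have := corank_le (Ct y Cy); have := corank_le_bottom y; lia.
have [C /andP[chC Ct] <-] : exists2 C : {set L},
    is_chain C && [forall u in C, (u <= t)%O] & #|C| = (n - c t).+1.
  move: {2}(n - c t) (erefl (n - c t)) => m; elim: m t => [|m IH] t ht.
    exists [set t]; rewrite ?cards1 ?ht //; apply/andP; split.
      by apply/is_chainP => x y; rewrite !inE => /eqP-> /eqP->; apply: comparablexx.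
    by apply/forall_inP => u; rewrite inE => /eqP ->.
  have [|z /andP[_ zt] cz] := @corank_interpolate bot t (c t).+1 (le0x t); first lia.
  have ltzt : (z < t)%O.
    by rewrite lt_neqAle zt andbT; apply/eqP => E; rewrite E in cz; lia.
  have [|C /andP[chC /forall_inP Cz] cC] := IH z; first lia.
  exists (t |: C).
    apply/andP; split.
      apply: is_chainU1 => // y /Cz yz; rewrite comparable_sym.
      exact/le_comparable/(le_trans yz).
    apply/forall_inP => y; rewrite !inE => /predU1P[->//|/Cz yz].
    exact: le_trans zt.
  have tC : t \notin C by apply/negP => /Cz /(lt_le_trans ltzt); rewrite ltxx.
  by rewrite cardsU1 cC tC; lia.
by apply: (bigop.bigmax_sup C) => //; rewrite chC.
Qed.

Lemma rank_corank t : rank t = n - c t.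
Proof. by rewrite /rank max_chain_card_le. Qed.

Lemma max_chain_card_corank : max_chain_card L = n.+1.
Proof.
rewrite -[n]subn0 -[in RHS]c_top -max_chain_card_le; apply: eq_bigl => C.
by rewrite [X in _ && X](_ : _ = true) ?andbT //; apply/forall_inP => u _; apply: lex1.
Qed.

(** Ranks become coranks by k -> n - k; the coranks [n] and 0 stand for the bottom and the top,
    which are always kept. *)
Definition selected_coranks (S : {fset nat}) : {set 'I_n.+1} :=
  [set k : 'I_n.+1 | [|| n - k \in S, k == n :> nat | k == 0 :> nat]].

Lemma rank_selected_corank S t :
  (t \in rank_selected L S) = (corank_ord t \in selected_coranks S).
Proof.
by rewrite !inE rank_corank corank_ordE corank_eq_top corank_eq_bottom.
Qed.

(** A chain with all selected coranks cannot grow, since coranks are distinct on chains. A maximal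
    one misses no selected corank, since a missing one could be interpolated. *)
Lemma alpha_corank S : alpha L S = #|chains_above bot (selected_coranks S)|.
Proof.
apply: eq_card => C; rewrite !inE.
have -> : [forall y in C, (bot <= y)%O] by apply/forall_inP => y _; apply: le0x.
have subsel (D : {set L}) : (D \subset rank_selected L S) =
    (corank_ord @: D \subset selected_coranks S).
  apply/subsetP/subsetP => [h _ /imsetP[t /h Dt ->]|h t Dt].
    by rewrite -rank_selected_corank.
  by rewrite rank_selected_corank h ?imset_f.
apply/maxsetP/andP => [[/andP[chC selC] Cmax]|[chC /eqP KC]]; last first.
  split; first by rewrite chC subsel KC /=.
  move=> D /andP[chD]; rewrite subsel -KC => /subsetP KD CD.
  apply/eqP; rewrite eqEsubset CD andbT; apply/subsetP => y Dy.
  have /imsetP[z Cz] := KD _ (imset_f corank_ord Dy).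
  by move/(chain_corank_inj chD) => -> //; apply: (subsetP CD).
have Cadd z : corank_ord z \in selected_coranks S ->
    {in C, forall y, (z >=< y)%O} -> z \in C.
  move=> zS zC; rewrite -(Cmax (z |: C)) ?setU11 ?subsetUr //.
  by rewrite is_chainU1 //= subUset selC andbT sub1set rank_selected_corank.
have Cbot : bot \in C.
  apply: Cadd => [|y _]; last exact/le_comparable/le0x.
  by rewrite -rank_selected_corank !inE eqxx orbT.
have Ctop : top \in C.
  apply: Cadd => [|y _]; last exact/ge_comparable/lex1.
  by rewrite -rank_selected_corank !inE eqxx !orbT.
split=> //; rewrite eqEsubset -subsel selC /=; apply/subsetP => k kS.
have Pbot : (bot \in C) && (k <= c bot) by rewrite Cbot -ltnS ltn_ord.
have Ptop : (top \in C) && (c top <= k) by rewrite Ctop c_top.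
(* The neighbours of corank [k] in the chain: u has the least corank >= k, v the greatest corank <=
   k. An element of corank [k] between them is comparable with all of [C]. *)
case: (@arg_minnP _ bot (fun y => (y \in C) && (k <= c y)) c Pbot) => u /andP[Cu ku] umin.
case: (@arg_maxnP _ top (fun y => (y \in C) && (c y <= k)) c Ptop) => v /andP[Cv kv] vmax.
have cmp : {in C &, forall x y, (x >=< y)%O} by apply/is_chainP.
have uv : (u <= v)%O by apply: comparable_corank_le; [apply: cmp|lia].
have [|z /andP[uz zv] cz] := @corank_interpolate u v k uv; first lia.
have zk : corank_ord z = k by apply: val_inj; rewrite /= corank_ordE.
rewrite -zk imset_f // Cadd ?zk // => y Cy.
case: (leqP k (c y)) => [ky|/ltnW ky].
  apply/ge_comparable/(le_trans _ uz)/comparable_corank_le; first exact: cmp.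
  by apply: umin; rewrite Cy.
apply/le_comparable/(le_trans zv)/comparable_corank_le; first exact: cmp.
by apply: vmax; rewrite Cy.
Qed.

End Corank.

(** * Type B partitions as kernels of odd functions *)

Section TypeB.
Variable n : nat.
Implicit Types (x y z : signed n) (P Q : typeB_partition n).

Definition sabs x : nat := absz (szval x).

Lemma soppK : involutive (@sopp n).
Proof. exact: rev_ordK. Qed.

Lemma szval_eq0 x : (szval x == 0)%R = (x == szero).
Proof. by rewrite -(szval0 n) (inj_eq (@szval_inj n)). Qed.

Lemma sabs_eq0 x : (sabs x == 0) = (x == szero).
Proof. by rewrite /sabs absz_eq0 szval_eq0. Qed.

Lemma sabs0 : sabs szero = 0.
Proof. by apply/eqP; rewrite sabs_eq0. Qed.

Lemma sabsN x : sabs (sopp x) = sabs x.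
Proof. by rewrite /sabs szvalN abszN. Qed.

Lemma sopp0 : sopp szero = szero :> signed n.
Proof. by apply/eqP; rewrite -sabs_eq0 sabsN sabs0. Qed.

Lemma sopp_fix x : sopp x = x -> x = szero.
Proof.
move=> /(congr1 szval); rewrite szvalN => h.
by apply/eqP; rewrite -szval_eq0; apply/eqP; lia.
Qed.

Lemma sabs_inj x y : sabs x = sabs y -> x = y \/ x = sopp y.
Proof.
rewrite /sabs => h; have [e|e] : (szval x = szval y \/ szval x = - szval y)%R by lia.
  by left; apply: szval_inj.
by right; apply: szval_inj; rewrite szvalN.
Qed.

Definition pos x : bool := (0 < szval x)%R.

Lemma posN x : pos x -> ~~ pos (sopp x).
Proof. by rewrite /pos szvalN; lia. Qed.

Lemma pos_cases x : [\/ pos x, pos (sopp x) | x = szero].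
Proof.
have [h|[h|h]] : (0 < szval x \/ 0 < - szval x \/ szval x = 0)%R by lia.
- by apply: Or31.
- by apply: Or32; rewrite /pos szvalN.
- by apply/Or33/eqP; rewrite -szval_eq0 h.
Qed.

Lemma pos0 : pos szero = false.
Proof. by rewrite /pos szval0. Qed.

Lemma mem_pblockB P x : x \in pblock (blocks P) x.
Proof.
by have /and3P[/eqP cP _ _] := blocks_partition P; rewrite mem_pblock cP inE.
Qed.

Lemma pblock_blocks P x : pblock (blocks P) x \in blocks P.
Proof.
by have /and3P[/eqP cP _ _] := blocks_partition P; rewrite pblock_mem ?cP ?inE.
Qed.

Lemma pblockBP P x y :
  reflect (pblock (blocks P) x = pblock (blocks P) y) (y \in pblock (blocks P) x).
Proof.
have /and3P[/eqP cP tP _] := blocks_partition P.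
by rewrite -eq_pblock ?cP ?inE //; apply: eqP.
Qed.

Lemma def_pblockB P B x : B \in blocks P -> x \in B -> pblock (blocks P) x = B.
Proof. by have /and3P[_ tP _] := blocks_partition P; apply: def_pblock. Qed.

Lemma pblockN P x : pblock (blocks P) (sopp x) = sopp @: pblock (blocks P) x.
Proof.
have /and3P[_ /forall_inP hN _] := blocksP P.
by apply: def_pblockB; rewrite ?hN ?pblock_blocks ?imset_f ?mem_pblockB.
Qed.

Lemma pblockN_eq P x y : pblock (blocks P) x = pblock (blocks P) y ->
  pblock (blocks P) (sopp x) = pblock (blocks P) (sopp y).
Proof. by rewrite !pblockN => ->. Qed.

(** Condition (ii) speaks of positive elements only; negation carries it over to negative ones. *)
Lemma pblock_zero P x : pblock (blocks P) x = pblock (blocks P) (sopp x) ->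
  pblock (blocks P) x = pblock (blocks P) szero.
Proof.
have /and3P[_ _ /forall_inP h0] := blocksP P.
wlog: x / pos x => [IH|px] hx.
  case: (pos_cases x) => [|px|->//]; first by move/IH; apply.
  by rewrite hx; apply: IH; rewrite // soppK.
apply/pblockBP; have /forallP/(_ x) := h0 _ (pblock_blocks P x).
rewrite subUset !sub1set mem_pblockB (introT (pblockBP _ _ _) hx) andbT.
by rewrite -/(pos x) px.
Qed.

Lemma leB_pblockP P Q :
  reflect (forall x y, pblock (blocks P) x = pblock (blocks P) y ->
             pblock (blocks Q) x = pblock (blocks Q) y)
          ((P : PiB n) <= Q)%O.
Proof.
apply: (iffP (refinesP P Q)) => [h x y /pblockBP xy|h B PB].
  have [C QC /subsetP BC] := h _ (pblock_blocks P x).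
  by rewrite (def_pblockB QC (BC _ (mem_pblockB P x))) (def_pblockB QC (BC _ xy)).
have /and3P[_ _ P0] := blocks_partition P.
have /set0Pn[x Bx] : B != set0 by apply: contraNneq P0 => <-.
exists (pblock (blocks Q) x); first exact: pblock_blocks.
apply/subsetP => y By; apply/pblockBP/h.
by rewrite (def_pblockB PB Bx) (def_pblockB PB By).
Qed.

(* The condition under which the fibres of [f] form a type B partition. *)
Definition odd_kernel (T : eqType) (f : signed n -> T) : bool :=
  [forall x, forall y, (f x == f y) ==> (f (sopp x) == f (sopp y))] &&
  [forall x, (f x == f (sopp x)) ==> (f x == f szero)].

(** The finest partition is a default value; the kernel is meaningful only under [odd_kernel f]. *)
Definition kernel (T : eqType) (f : signed n -> T) : typeB_partition n :=
  insubd (finest n) (preim_partition f [set: signed n]).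

Lemma blocks_kernel (T : eqType) (f : signed n -> T) : odd_kernel f ->
  blocks (kernel f) = preim_partition f [set: signed n].
Proof.
move=> /andP[/forallP hN /forallP h0]; apply: (insubdK (finest n)).
apply/and3P; split; first exact: preim_partitionP.
- apply/forall_inP => _ /imsetP[x _ ->]; apply/imsetP; exists (sopp x) => //.
  have {}hN y z : (f y == f z) = (f (sopp y) == f (sopp z)).
    apply/idP/idP; first by apply/implyP; have /forallP := hN y.
    by rewrite -{2}(soppK y) -{2}(soppK z); apply/implyP; have /forallP := hN (sopp y).
  apply/setP => y; rewrite !inE; apply/imsetP/idP => [[z]|xy].
    by rewrite !inE => xz ->; rewrite -hN.
  by exists (sopp y); rewrite ?soppK // !inE hN soppK.
- apply/forall_inP => _ /imsetP[x _ ->]; apply/forallP => y; apply/implyP.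
  rewrite subUset !sub1set !inE => /and3P[_ /eqP fxy /eqP fxNy].
  by rewrite fxy; apply: (implyP (h0 y)); rewrite -fxy fxNy.
Qed.

Lemma pblock_kernel (T : eqType) (f : signed n -> T) x y : odd_kernel f ->
  (pblock (blocks (kernel f)) x = pblock (blocks (kernel f)) y) <-> (f x = f y).
Proof.
move=> hf; have E : (y \in pblock (blocks (kernel f)) x) = (f x == f y).
  rewrite blocks_kernel // /preim_partition pblock_equivalence_partition ?inE //.
  by split=> // /eqP->.
split; first by move/pblockBP; rewrite E => /eqP.
by move/eqP; rewrite -E => /pblockBP.
Qed.

Lemma card_blocks_kernel (T : finType) (f : signed n -> T) : odd_kernel f ->
  #|blocks (kernel f)| = #|f @: [set: signed n]|.
Proof.
move=> /blocks_kernel ->.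
rewrite -(card_in_imset (f := fun t => [set y | f y == t])).
  rewrite -imset_comp; apply/eq_card/setP/eq_imset => x /=; apply/setP => y.
  by rewrite !inE eq_sym.
move=> _ _ /imsetP[x _ ->] /imsetP[y _ ->] /setP/(_ x).
by rewrite !inE eqxx => /esym/eqP.
Qed.

Lemma odd_kernel_signed (f : signed n -> signed n) :
  (forall x, f (sopp x) = sopp (f x)) -> odd_kernel f.
Proof.
move=> hf; apply/andP; split.
  by apply/forallP => x; apply/forallP => y; rewrite !hf (inj_eq (@sopp_inj n)) implybb.
apply/forallP => x; apply/implyP => /eqP; rewrite hf => /esym/sopp_fix ->.
by apply/eqP/esym/sopp_fix; rewrite -hf sopp0.
Qed.

(* An element of least absolute value; it is unique because a block containing
   both y and -y contains 0. *)
Definition rep P x : signed n := [arg min_(y < x in pblock (blocks P) x) sabs y].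

Lemma pblock_rep P x : pblock (blocks P) (rep P x) = pblock (blocks P) x.
Proof.
by rewrite /rep; case: arg_minnP => [|y /pblockBP]; first exact: mem_pblockB.
Qed.

Lemma rep_le P x y : pblock (blocks P) x = pblock (blocks P) y ->
  sabs (rep P x) <= sabs y.
Proof.
move=> /pblockBP xy; rewrite /rep; case: arg_minnP => [|z _]; last exact.
exact: mem_pblockB.
Qed.

Lemma rep_uniq P x y : pblock (blocks P) y = pblock (blocks P) x ->
  sabs y <= sabs (rep P x) -> y = rep P x.
Proof.
move=> yx hy; have [//|yN] : y = rep P x \/ y = sopp (rep P x).
  by apply/sabs_inj/eqP; rewrite eqn_leq hy rep_le.
have y0 : pblock (blocks P) y = pblock (blocks P) szero.
  by apply: pblock_zero; rewrite {2}yN soppK pblock_rep.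
have : sabs (rep P x) <= sabs szero by apply: rep_le; rewrite -yx.
by rewrite sabs0 leqn0 sabs_eq0 yN => /eqP ->; rewrite sopp0.
Qed.

Lemma rep_eqP P x y :
  (rep P x = rep P y) <-> (pblock (blocks P) x = pblock (blocks P) y).
Proof.
split=> [h|h]; first by rewrite -pblock_rep h pblock_rep.
by apply: rep_uniq; rewrite ?pblock_rep // rep_le // pblock_rep.
Qed.

Lemma rep_id P x : rep P (rep P x) = rep P x.
Proof. by apply/rep_eqP; rewrite pblock_rep. Qed.

Lemma repN P x : rep P (sopp x) = sopp (rep P x).
Proof.
apply/esym/rep_uniq; first by apply/pblockN_eq/pblock_rep.
rewrite sabsN; have -> : sabs (rep P (sopp x)) = sabs (sopp (rep P (sopp x))).
  by rewrite sabsN.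
by apply: rep_le; rewrite -[in LHS](soppK x); apply/pblockN_eq/esym/pblock_rep.
Qed.

Lemma rep0 P : rep P szero = szero.
Proof. by apply/sopp_fix; rewrite -repN sopp0. Qed.

Lemma odd_kernel_rep P : odd_kernel (rep P).
Proof. exact/odd_kernel_signed/repN. Qed.

Lemma kernel_rep P : kernel (rep P) = P.
Proof.
apply: (@le_anti _ (PiB n)); apply/andP; split; apply/leB_pblockP => x y.
  by move/(pblock_kernel _ _ (odd_kernel_rep P)); apply: (proj1 (rep_eqP P x y)).
by move/(rep_eqP P)/(pblock_kernel _ _ (odd_kernel_rep P)).
Qed.

Definition reps P : {set signed n} := [set x | rep P x == x].
(** One representative for each pair {B, -B} of nonzero blocks. *)
Definition pos_reps P : {set signed n} := [set x in reps P | pos x].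

Lemma reps_imset P : reps P = rep P @: [set: signed n].
Proof.
apply/setP => x; rewrite inE; apply/eqP/imsetP => [<-|[y _ ->]]; last exact: rep_id.
by exists x.
Qed.

Lemma card_reps P : #|reps P| = #|blocks P|.
Proof. by rewrite reps_imset -card_blocks_kernel ?odd_kernel_rep // kernel_rep. Qed.

Lemma reps_oppE P x : (sopp x \in reps P) = (x \in reps P).
Proof. by rewrite !inE repN (inj_eq (@sopp_inj n)). Qed.

Lemma card_pos_reps P : #|reps P| = (#|pos_reps P|).*2.+1.
Proof.
have -> : reps P = szero |: (pos_reps P :|: sopp @: pos_reps P).
  apply/setP => x; rewrite !inE.
  have -> : (x \in sopp @: pos_reps P) = (x \in reps P) && pos (sopp x).
    apply/imsetP/andP => [[y]|[xP px]].
      by rewrite inE => /andP[yP py] ->; rewrite reps_oppE soppK.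
    by exists (sopp x); rewrite ?soppK // inE reps_oppE xP.
  rewrite !inE; case: (x =P szero) => [->|/eqP x0] /=; first by rewrite rep0 eqxx.
  case: (pos_cases x) => [->|->|x0']; rewrite ?andbT ?orbT ?orbb //.
  - by case: (rep P x == x).
  - by case: (rep P x == x); rewrite ?orbT.
  - by rewrite x0' eqxx in x0.
rewrite cardsU1 cardsU card_imset; last exact: sopp_inj.
have -> : pos_reps P :&: sopp @: pos_reps P = set0.
  apply/setP => x; rewrite !inE; apply/negP => /andP[/andP[_ px] /imsetP[y]].
  by rewrite inE => /andP[_ /posN/negP py] xy; rewrite xy in px.
rewrite cards0 subn0 addnn !inE pos0 andbF /=.
rewrite (_ : szero \in _ = false) //; apply/negP => /imsetP[y].
by rewrite inE => /andP[_ py] y0; move: py; rewrite -(soppK y) -y0 sopp0 pos0.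
Qed.

(** Apart from the zero block, blocks come in pairs {B, -B}, so half the number of blocks, rounded
    down, is the number m(pi) of pairs. *)
Definition corank P : nat := #|blocks P|./2.

Lemma corankE P : corank P = #|pos_reps P|.
Proof. by rewrite /corank -card_reps card_pos_reps /= uphalf_double. Qed.

Lemma corank_bottom : corank (Order.bottom : PiB n) = n.
Proof.
rewrite /corank card_imset; last exact: set1_inj.
by rewrite cardsT card_ord /= uphalf_double.
Qed.

Lemma corank_top : corank (Order.top : PiB n) = 0.
Proof. by rewrite /corank cards1. Qed.

(** A representative for the coarser [Q] is also least in its smaller [P]-block, so [reps Q] lies in
    [reps P]; equality would force [Q] to refine [P]. *)
Lemma corank_anti P Q : ((P : PiB n) < Q)%O -> corank Q < corank P.
Proof.
rewrite lt_leAnge => /andP[PQ nQP]; move/leB_pblockP: (PQ) => hPQ.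
have sub : reps Q \subset reps P.
  apply/subsetP => x; rewrite !inE => /eqP Qx; apply/eqP/esym/rep_uniq => //.
  by rewrite -{1}Qx; apply/rep_le/esym/hPQ/pblock_rep.
suff : #|reps Q| < #|reps P| by rewrite !card_pos_reps -!corankE; lia.
apply: proper_card; rewrite properE sub /=; apply: contra nQP => /subsetP subPQ.
apply/leB_pblockP => x y Qxy; apply/rep_eqP.
have Qrep z : rep Q (rep P z) = rep P z.
  by apply/eqP; have := subPQ (rep P z); rewrite !inE rep_id eqxx; apply.
rewrite -Qrep -[RHS]Qrep; apply/rep_eqP.
have hr z : pblock (blocks Q) (rep P z) = pblock (blocks Q) z.
  by apply/hPQ/pblock_rep.
by rewrite !hr.
Qed.

(** Merges two blocks of [P] lying in one block of [Q], together with their negatives, by replacing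
    the representatives b and -b with a and -a. *)
Lemma corank_cover P Q : ((P : PiB n) < Q)%O ->
  exists2 R : PiB n, ((P : PiB n) < R <= Q)%O & corank P = (corank R).+1.
Proof.
rewrite lt_leAnge => /andP[/leB_pblockP hPQ nQP].
have [a [b [aP bP Qab ltab]]] : exists a b, [/\ rep P a = a, rep P b = b,
    pblock (blocks Q) a = pblock (blocks Q) b & sabs a < sabs b].
  have [[x y] /=/andP[/eqP Qxy nPxy]] : exists p : signed n * signed n,
      (pblock (blocks Q) p.1 == pblock (blocks Q) p.2) && (rep P p.1 != rep P p.2).
    apply/existsP; apply: contraR nQP; rewrite negb_exists => /forallP h.
    apply/leB_pblockP => x y Qxy; apply/rep_eqP/eqP.
    by have := h (x, y); rewrite /= Qxy eqxx /= negbK.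
  have {}Qxy : pblock (blocks Q) (rep P x) = pblock (blocks Q) (rep P y).
    by rewrite (hPQ _ x (pblock_rep P x)) (hPQ _ y (pblock_rep P y)).
  case: (ltngtP (sabs (rep P x)) (sabs (rep P y))) => hxy.
  - by exists (rep P x), (rep P y); rewrite !rep_id.
  - by exists (rep P y), (rep P x); rewrite !rep_id.
  have [xy|xy] := sabs_inj hxy; first by rewrite xy eqxx in nPxy.
  (* Opposite representatives in one block of [Q] force that block to contain 0, so 0 can serve as
     a. *)
  exists szero, (rep P y); rewrite rep0 rep_id; split=> //.
    by apply/esym/pblock_zero; rewrite -xy.
  rewrite sabs0 lt0n sabs_eq0; apply: contraNneq nPxy => y0.
  by rewrite xy y0 sopp0.
have b0 : b != szero by rewrite -sabs_eq0 -lt0n; apply: leq_ltn_trans ltab.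
have bN : sopp b != b by apply: contraNneq b0 => /sopp_fix ->.
have anb : a != b by apply: contraTneq ltab => ->; rewrite ltnn.
have anNb : a != sopp b by apply: contraTneq ltab => ->; rewrite sabsN ltnn.
pose g z := if z == b then a else if z == sopp b then sopp a else z.
pose f x := g (rep P x).
have gN z : g (sopp z) = sopp (g z).
  rewrite /g (inj_eq (@sopp_inj n)) -{1}(soppK b) (inj_eq (@sopp_inj n)).
  by case: (z =P b) => [->|_]; [rewrite eq_sym (negbTE bN)|case: eqP; rewrite ?soppK].
have fok : odd_kernel f by apply: odd_kernel_signed => x; rewrite /f repN gN.
have Qg z : pblock (blocks Q) (g z) = pblock (blocks Q) z.
  rewrite /g; case: eqP => [->//|_]; case: eqP => [->|//]; exact: pblockN_eq.
have fa : f a = a by rewrite /f aP /g (negbTE anb) (negbTE anNb).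
have fb : f b = a by rewrite /f bP /g eqxx.
exists (kernel f).
  rewrite lt_leAnge -andbA; apply/and3P; split.
  - apply/leB_pblockP => x y /rep_eqP Pxy; apply/pblock_kernel => //.
    by rewrite /f Pxy.
  - apply/negP => /leB_pblockP /(_ a b) h; move/eqP: anb; apply.
    by rewrite -aP -bP; apply/rep_eqP/h/pblock_kernel; rewrite // fa fb.
  apply/leB_pblockP => x y /(pblock_kernel _ _ fok) fxy.
  by rewrite -(hPQ _ _ (pblock_rep P x)) -(hPQ _ _ (pblock_rep P y)) -Qg -/(f x) fxy Qg.
rewrite /corank card_blocks_kernel // -card_reps.
(* Since |a| < |b|, neither a nor -a is b or -b; exactly these two values disappear, and the corank
   drops by one. *)
have -> : f @: [set: signed n] = (reps P :\ b) :\ sopp b.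
  apply/setP => z; rewrite !inE; apply/imsetP/and3P => [[x _ ->]|[zNb zb /eqP Pz]].
    rewrite /f /g; have [_|xb] := eqVneq (rep P x) b; first by rewrite aP eqxx anb anNb.
    have [_|xNb] := eqVneq (rep P x) (sopp b); last by rewrite xb xNb rep_id eqxx.
    rewrite repN aP eqxx (inj_eq (@sopp_inj n)) anb; split=> //.
    by apply: contraNneq anNb => <-; rewrite soppK.
  by exists z; rewrite // /f Pz /g (negbTE zb) (negbTE zNb).
rewrite (cardsD1 b (reps P)) (cardsD1 (sopp b) (reps P :\ b)) !inE bP eqxx bN.
by rewrite repN bP eqxx.
Qed.

End TypeB.

(** * Counting odd functions *)

Section OddFunctions.
Variables n q : nat.
Implicit Types (x y z : signed n) (P Q : typeB_partition n).

(* A copy of {-q, ..., q}: [None] is 0, and [Some (b, i)] is i + 1 with sign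
   [b]. *)
Local Notation Y := (option (bool * 'I_q)).
Implicit Type f : {ffun signed n -> Y}.

Definition oppY (v : Y) : Y := omap (fun p => (~~ p.1, p.2)) v.

Lemma oppYK : involutive oppY.
Proof. by case=> [[b i]|] //=; rewrite negbK. Qed.

Lemma oppY_fix v : oppY v = v -> v = None.
Proof. by case: v => [[[] i]|]. Qed.

Definition odd_fun (f : {ffun signed n -> Y}) : bool :=
  [forall x, f (sopp x) == oppY (f x)].

Lemma odd_funP f : reflect (forall x, f (sopp x) = oppY (f x)) (odd_fun f).
Proof. by apply: (iffP forallP) => h x; apply/eqP. Qed.

Lemma odd_fun0 f : odd_fun f -> f szero = None.
Proof. by move=> /odd_funP h; apply: oppY_fix; rewrite -h sopp0. Qed.

Lemma odd_kernel_odd_fun f : odd_fun f -> odd_kernel f.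
Proof.
move=> hf; move/odd_funP: (hf) => fN; apply/andP; split.
  by apply/forallP => x; apply/forallP => y; apply/implyP; rewrite !fN => /eqP ->.
apply/forallP => x; apply/implyP => /eqP; rewrite fN odd_fun0 // => /esym/oppY_fix ->.
by [].
Qed.

Section Extension.
Variable P : typeB_partition n.

Local Notation D := {x : signed n | x \in pos_reps P}.

(** The values at positive representatives are free; oddness determines those at negative ones and
    forces [None] at 0. *)
Definition odd_ext_at (g : {ffun D -> Y}) y : Y :=
  if insub y is Some t then g t else
  if insub (sopp y) is Some t then oppY (g t) else None.

Definition odd_ext (g : {ffun D -> Y}) : {ffun signed n -> Y} :=
  [ffun x => odd_ext_at g (rep P x)].

Lemma pos_reps_rep (t : D) : rep P (val t) = val t.
Proof. by have := valP t; rewrite !inE => /andP[/eqP]. Qed.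

Lemma pos_reps_pos (t : D) : pos (val t).
Proof. by have := valP t; rewrite !inE => /andP[_]. Qed.

Lemma pos_repsN (t : D) : sopp (val t) \notin pos_reps P.
Proof. by rewrite inE negb_and posN ?orbT ?pos_reps_pos. Qed.

Lemma odd_ext_at_val g (t : D) : odd_ext_at g (val t) = g t.
Proof. by rewrite /odd_ext_at valK. Qed.

Lemma odd_ext_at_opp g (t : D) : odd_ext_at g (sopp (val t)) = oppY (g t).
Proof. by rewrite /odd_ext_at insubN ?pos_repsN // soppK valK. Qed.

Lemma odd_ext_at0 g : odd_ext_at g szero = None.
Proof. by rewrite /odd_ext_at sopp0 insubN // inE pos0 andbF. Qed.

Variant reps_spec : signed n -> Prop :=
  | RepsPos (t : D) : reps_spec (val t)
  | RepsNeg (t : D) : reps_spec (sopp (val t))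
  | RepsZero : reps_spec szero.

Lemma repsP y : y \in reps P -> reps_spec y.
Proof.
move=> yP; case: (pos_cases y) => [py|py|->]; last exact: RepsZero.
  have yD : y \in pos_reps P by rewrite inE yP.
  exact: (RepsPos (Sub y yD)).
have yD : sopp y \in pos_reps P by rewrite inE reps_oppE yP.
by rewrite -(soppK y); apply: (RepsNeg (Sub (sopp y) yD)).
Qed.

Lemma rep_reps x : rep P x \in reps P.
Proof. by rewrite inE rep_id. Qed.

Lemma odd_ext_atN g y : y \in reps P ->
  odd_ext_at g (sopp y) = oppY (odd_ext_at g y).
Proof.
move=> /repsP[t|t|]; rewrite ?soppK ?sopp0 ?odd_ext_at0 //.
- by rewrite odd_ext_at_val odd_ext_at_opp.
- by rewrite odd_ext_at_opp odd_ext_at_val oppYK.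
Qed.

Lemma odd_ext_odd g : odd_fun (odd_ext g).
Proof. by apply/odd_funP => x; rewrite !ffunE repN odd_ext_atN ?rep_reps. Qed.

Lemma odd_ext_inj : injective odd_ext.
Proof.
move=> g h /ffunP E; apply/ffunP => t; have := E (val t).
by rewrite !ffunE pos_reps_rep !odd_ext_at_val.
Qed.

Definition odd_on : {set {ffun signed n -> Y}} :=
  [set f | odd_fun f && ((P : PiB n) <= kernel f)%O].

Lemma odd_onP f : reflect (odd_fun f /\ forall x, f (rep P x) = f x) (f \in odd_on).
Proof.
rewrite inE; apply: (iffP andP) => [[hf /leB_pblockP h]|[hf h]]; split=> //.
  by move=> x; apply/(pblock_kernel _ _ (odd_kernel_odd_fun hf))/h/pblock_rep.
apply/leB_pblockP => x y /rep_eqP xy.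
by apply/(pblock_kernel _ _ (odd_kernel_odd_fun hf)); rewrite -h xy h.
Qed.

Lemma odd_ext_surj f : f \in odd_on -> f = odd_ext [ffun t => f (val t)].
Proof.
move=> /odd_onP[hf hr]; apply/ffunP => x; rewrite ffunE -hr.
case: (repsP (rep_reps x)) => [t|t|].
- by rewrite odd_ext_at_val ffunE.
- by rewrite odd_ext_at_opp ffunE (odd_funP _ hf).
- by rewrite odd_ext_at0 odd_fun0.
Qed.

Lemma odd_ext_on g : odd_ext g \in odd_on.
Proof. by apply/odd_onP; split=> [|x]; rewrite ?odd_ext_odd // !ffunE rep_id. Qed.

Lemma card_odd_on : #|odd_on| = (2 * q + 1) ^ corank P.
Proof.
have -> : odd_on = odd_ext @: setT.
  apply/setP => f; apply/idP/imsetP => [/odd_ext_surj ->|[g _ ->]].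
    by eexists.
  exact: odd_ext_on.
rewrite card_imset; last exact: odd_ext_inj.
rewrite cardsT card_ffun card_option card_prod card_bool card_ord card_sig addn1.
by rewrite corankE.
Qed.

(** The functions that avoid 0, split into sign and absolute value; those with distinct absolute
    values are the ones whose extension has kernel exactly [P]. *)
Definition signed_ffun (p : {ffun D -> bool} * {ffun D -> 'I_q}) : {ffun D -> Y} :=
  [ffun t => Some (p.1 t, p.2 t)].

Lemma signed_ffun_inj : injective signed_ffun.
Proof.
move=> [b h] [b' h'] /ffunP E; congr (_, _); apply/ffunP => t;
  by have := E t; rewrite !ffunE /= => -[].
Qed.

Lemma kernel_odd_ext_signed b (h : {ffun D -> 'I_q}) : injective h ->
  kernel (odd_ext (signed_ffun (b, h))) = P.
Proof.
set f := odd_ext _ => hinj.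
have fok : odd_kernel f by apply/odd_kernel_odd_fun/odd_ext_odd.
apply: (@le_anti _ (PiB n)); apply/andP; split; last first.
  by have := odd_ext_on (signed_ffun (b, h)); rewrite inE => /andP[].
apply/leB_pblockP => x y /(pblock_kernel _ _ fok) fxy; apply/rep_eqP.
move: fxy; rewrite !ffunE.
case: (repsP (rep_reps x)) => [t|t|]; case: (repsP (rep_reps y)) => [u|u|];
  rewrite ?odd_ext_at_val ?odd_ext_at_opp ?odd_ext_at0 ?ffunE //=.
- by case=> _ /hinj ->.
- by case=> + /hinj tu; rewrite tu; case: (b u).
- by case=> + /hinj tu; rewrite tu; case: (b u).
- by case=> _ /hinj ->.
Qed.

(** A value 0 would place a positive representative in the zero block. Equal absolute values give t
    = u or t = -u, and positivity excludes the latter. *)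
Lemma kernel_odd_extP (g : {ffun D -> Y}) : kernel (odd_ext g) = P ->
  exists2 p : {ffun D -> bool} * {ffun D -> 'I_q},
    injective p.2 & g = signed_ffun p.
Proof.
set f := odd_ext g => fP.
have hf : odd_fun f by apply: odd_ext_odd.
have ft t : f (val t) = g t by rewrite ffunE pos_reps_rep odd_ext_at_val.
have finj x y : f x = f y -> rep P x = rep P y.
  move=> fxy; apply/rep_eqP; rewrite -fP.
  exact/(pblock_kernel _ _ (odd_kernel_odd_fun hf)).
have /fin_all_exists[p gp] t : exists p, g t = Some p.
  case E: (g t) => [p|]; first by exists p.
  have := finj (val t) szero; rewrite ft E odd_fun0 // rep0 pos_reps_rep.
  by move=> /(_ erefl) t0; have := pos_reps_pos t; rewrite t0 pos0.
exists ([ffun t => (p t).1], [ffun t => (p t).2]); last first.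
  by apply/ffunP => t; rewrite !ffunE /= gp; case: (p t).
move=> t u /=; rewrite !ffunE => ptu; apply: val_inj => /=.
case: (boolP ((p t).1 == (p u).1)) => [/eqP btu|btu].
  have := finj (val t) (val u); rewrite !ft !pos_reps_rep; apply.
  by rewrite !gp; case: (p t) (p u) ptu btu => [? ?] [? ?] /= -> ->.
have tu : val t = sopp (val u).
  have := finj (val t) (sopp (val u)).
  rewrite (odd_funP _ hf) repN !ft !pos_reps_rep; apply.
  rewrite !gp; case: (p t) (p u) ptu btu => [b ?] [b' ?] /= -> bb' /=.
  by congr (Some (_, _)); case: b b' bb' => [] [].
by have := posN (pos_reps_pos u); rewrite -tu pos_reps_pos.
Qed.

Lemma card_odd_kernel :
  #|[set f | odd_fun f & kernel f == P]| = 2 ^ corank P * q ^_ corank P.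
Proof.
have -> : [set f | odd_fun f & kernel f == P] =
    odd_ext @: (signed_ffun @: setX setT [set h : {ffun D -> 'I_q} | injectiveb h]).
  apply/setP => f; rewrite inE; apply/andP/imsetP => [[hf /eqP fP]|[g]].
    have fon : f \in odd_on by rewrite inE hf fP lexx.
    exists [ffun t => f (val t)]; last exact: odd_ext_surj.
    have [|p pinj ->] := @kernel_odd_extP [ffun t => f (val t)].
      by rewrite -odd_ext_surj.
    by apply: imset_f; rewrite !inE; apply/injectiveP.
  move=> /imsetP[[b h]]; rewrite !inE => /injectiveP hinj -> ->.
  by rewrite odd_ext_odd kernel_odd_ext_signed.
rewrite !card_imset; [|exact: signed_ffun_inj|exact: odd_ext_inj].
rewrite cardsX cardsT card_inj_ffuns card_ffun card_bool card_ord card_sig.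
by rewrite corankE.
Qed.

End Extension.

Lemma corank_lt P : corank P < n.+1.
Proof.
have := @corank_le_bottom _ (PiB n) (@corank n) (@corank_anti n) P.
by rewrite corank_bottom.
Qed.

(** Counts the odd functions constant on the blocks of [P] in two ways: all at once, and by their
    kernel, an element above [P]. *)
Lemma expn_corank P : (2 * q + 1) ^ corank P =
  \sum_(k < n.+1) #|[set Q : PiB n | (P <= Q)%O & corank Q == k]| *
    (2 ^ k * q ^_ k).
Proof.
rewrite -card_odd_on -[LHS]sum1_card.
rewrite (partition_big (fun f : {ffun signed n -> Y} => kernel f) (fun Q : PiB n => (P <= Q)%O)) /=; last first.
  by move=> f; rewrite inE => /andP[].
rewrite (partition_big (fun Q : PiB n => inord (corank Q) : 'I_n.+1) xpredT) //=.
apply: eq_bigr => k _; rewrite -sum1_card big_distrl /=.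
have corank_inord (Q : PiB n) : (inord (corank Q) == k) = (corank Q == k).
  by rewrite -val_eqE /= inordK // corank_lt.
apply: eq_big => [Q|Q /andP[PQ]]; first by rewrite inE corank_inord.
rewrite corank_inord => /eqP <-; rewrite mul1n -card_odd_kernel -sum1_card.
apply: eq_bigl => f; rewrite !inE; case: eqP => [->|]; rewrite ?andbF //.
by rewrite PQ !andbT.
Qed.

End OddFunctions.

(** For k <= n both sides are coefficients of the same power of 2q + 1 in the basis 2^k
    q(q-1)...(q-k+1); for k > n both vanish. *)
Lemma card_above_corank n (P : PiB n) k :
  #|[set Q : PiB n | (P <= Q)%O & corank Q == k]| = stirlingB (corank P) k.
Proof.
case: (ltnP k n.+1) => hk; last first.
  rewrite stirlingB_small; last by apply: leq_trans hk; apply: corank_lt.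
  apply: eq_card0 => Q; rewrite !inE; apply/negP => /andP[_ /eqP ck].
  by have := corank_lt Q; rewrite ck ltnNge hk.
move: k hk; apply: ffact_coef_uniq => q.
by rewrite -expn_corank -expn_stirlingB // corank_lt.
Qed.

(** * Inclusion-exclusion *)

Local Open Scope fset_scope.
Local Open Scope ring_scope.

(** Expand a product over [I] in which elements of [D] contribute y and all others y + z. The case z
    = -1 serves Moebius inversion, z = 1 the h-polynomial. *)
Lemma sum_supersets (R : comNzRingType) (I : finType) (D : {set I}) (y z : R) :
  \sum_(K : {set I}) (D \subset K)%:R * (y ^+ #|K| * z ^+ #|~: K|) =
  y ^+ #|D| * (y + z) ^+ #|~: D|.
Proof.
have prodE (a b : R) (K : {set I}) :
    \prod_i (if i \in K then a else b) = a ^+ #|K| * b ^+ #|~: K|.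
  rewrite (bigID (mem K)) /=; congr (_ * _).
    by rewrite -prodr_const; apply: eq_bigr => i ->.
  rewrite -prodr_const; apply: eq_big => i; first by rewrite inE.
  by move/negbTE ->.
have -> : y ^+ #|D| * (y + z) ^+ #|~: D| =
    \prod_i (y + (if i \in D then 0 else z)).
  by rewrite -prodE; apply: eq_bigr => i _; case: ifP; rewrite ?addr0.
rewrite bigA_distr; apply: eq_bigr => K _; case: (boolP (D \subset K)) => DK.
  rewrite mul1r -prodE; apply: eq_bigr => i _.
  by case: (boolP (i \in K)) => // /(contra (subsetP DK i))/negbTE ->.
have /subsetPn[i Di nKi] := DK.
by rewrite mul0r (bigD1 i) //= (negbTE nKi) Di mul0r.
Qed.

Lemma sum_fpowerset_fsub (R : nmodType) (T : choiceType) (S : {fset T})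
    (F : {set S} -> R) :
  \sum_(A <- fpowerset S) F (fsub S A) = \sum_(J : {set S}) F J.
Proof.
rewrite -(big_map (fsub S) xpredT F); apply: perm_big; apply: uniq_perm.
- rewrite map_inj_in_uniq ?fset_uniq // => A B.
  by rewrite !fpowersetE; apply: fsub_inj.
- exact: index_enum_uniq.
move=> J; rewrite mem_index_enum; apply/mapP; exists [fsetval y in J].
  by rewrite fpowersetE; apply: fset_sub_val.
by apply/setP => x; rewrite in_fsub (in_fset_valT _ _ (valP x)) /= fsetsubE.
Qed.

(** Moebius inversion on subsets: for E inside S, [sum_supersets] at y = 1 and z = -1 yields 0 to
    the power |S \ E|. *)
Lemma sum_fpowerset_sign (T : choiceType) (S E : {fset T}) :
  \sum_(A <- fpowerset S) (-1) ^+ #|` S `\` A| * (E `<=` A)%:R =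
  (E == S)%:R :> int.
Proof.
case: (boolP (E `<=` S)) => ES; last first.
  rewrite big_seq big1 => [|A].
    by case: eqP => [E'|//]; rewrite E' fsubset_refl in ES.
  rewrite fpowersetE => AS; case: (boolP (E `<=` A)) => [EA|]; last by rewrite mulr0.
  by rewrite (fsubset_trans EA AS) in ES.
have := sum_supersets (fsub S E) (1 : int) (-1).
rewrite -sum_fpowerset_fsub subrr expr1n mul1r expr0n cards_eq0.
have -> : (~: fsub S E == set0)%SET = (E == S).
  rewrite -setCT (inj_eq (@setC_inj _)) -fsubT; apply/eqP/eqP => [|-> //].
  by move/(@fsub_inj _ S); rewrite -!topredE /=; apply; rewrite ?fsubset_refl.
move=> <-; rewrite big_seq [RHS]big_seq; apply: eq_bigr => A.
rewrite fpowersetE => AS; rewrite expr1n mul1r mulrC.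
rewrite subset_fsubE //; congr (_ * _ ^+ _).
by rewrite -setTD -fsubT -fsubD card_fsub // fsubsetDl.
Qed.

(** * Descent sets *)

Lemma descents_inP (K : pred nat) w :
  reflect (forall i, i \in Des w -> K i) (descents_in K w).
Proof.
apply: (iffP allP) => [h i|h i hi].
  by rewrite !inE => /andP[hi]; apply/implyP/h.
by apply/implyP => hw; apply: h; rewrite !inE /= hi.
Qed.

Lemma Des_range w i : i \in Des w -> (0 < i < size w)%N.
Proof. by rewrite !inE mem_iota => /andP[hi _]; lia. Qed.

Lemma card_ord_fset N (A : {fset nat}) : (forall i, i \in A -> (i < N)%N) ->
  #|[set k : 'I_N | (k : nat) \in A]| = #|` A|.
Proof.
move=> hA; rewrite cardE -(size_map val); apply/perm_size/uniq_perm.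
- by rewrite (map_inj_uniq val_inj) enum_uniq.
- exact: fset_uniq.
move=> i; apply/mapP/idP => [[k]|iA]; first by rewrite mem_enum inE => kA ->.
by exists (Ordinal (hA i iA)); rewrite // mem_enum inE.
Qed.

Lemma natr_count (R : pzSemiRingType) (T : Type) (a : pred T) (s : seq T) :
  (count a s)%:R = \sum_(w <- s) (a w)%:R :> R.
Proof.
elim: s => [|w s IH]; first by rewrite big_nil.
by rewrite big_cons /= natrD IH.
Qed.

(** The map i -> n - i is an involution of [n - 1]. *)
Lemma eq_subn_imfset (n : nat) (A B : {fset nat}) :
  A `<=` interval1 n.-1 -> B `<=` interval1 n.-1 ->
  ([fset (n - i)%N | i in A] == B) = (A == [fset (n - i)%N | i in B]).
Proof.
have subnKs C : C `<=` interval1 n.-1 ->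
    [fset (n - i)%N | i in [fset (n - j)%N | j in C]] = C.
  move=> /fsubsetP hC; apply/fsetP => i; apply/imfsetP/idP => /= [[_ /imfsetP[/= j Cj ->] ->]|Ci].
    by have := hC j Cj; rewrite !inE mem_iota => hj; rewrite subKn //; lia.
  have := hC i Ci; rewrite !inE mem_iota => hi.
  by exists (n - i)%N; [apply: in_imfset|lia].
by move=> hA hB; apply/eqP/eqP => [<-|->]; rewrite subnKs.
Qed.

(** * Flag numbers and h-polynomial of the type B partition lattice *)

Section Conclusion.
Variable n : nat.

Local Notation bot := (Order.bottom : PiB n).
Local Notation corank := (@corank n : PiB n -> nat).

Lemma card_chains_above_PiB (K : {set 'I_(corank bot).+1}) :
  #|@chains_above _ (PiB n) corank bot K| =
  count (descents_in (fun i => inord i \in K)) (Bmset n).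
Proof.
rewrite card_chains_above.
- by rewrite [X in nb_descents_in _ X]corank_bottom.
- exact: corank_anti.
- exact: card_above_corank.
- by move=> k _; rewrite -ltnS ltn_ord.
Qed.

Definition Des_compl (w : seq nat) : {fset nat} := [fset (n - i)%N | i in Des w].

Lemma alpha_PiB (S : {fset nat}) :
  alpha (PiB n) S = count (fun w => Des_compl w `<=` S) (Bmset n).
Proof.
rewrite (@alpha_corank _ _ corank); first last.
- exact: corank_cover.
- exact: corank_top.
- exact: corank_anti.
rewrite card_chains_above_PiB; apply: eq_in_count => w /Bmset_shape[sw _].
(* The coranks 0 and n, selected for top and bottom, are not descent positions in a word of length
   n, so only membership of n - i in [S] remains. *)
have KE i : (0 < i < n)%N ->
    (inord i \in selected_coranks corank S) = ((n - i)%N \in S).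
  move=> hi; rewrite inE inordK !corank_bottom; last by lia.
  by rewrite [X in _ || X](_ : _ = false) ?orbF //; lia.
apply/descents_inP/fsubsetP => [h _ /imfsetP[i /= iw ->]|h i iw].
  by rewrite -KE; [apply: h|rewrite -sw Des_range].
by rewrite KE -?sw ?Des_range // sw; apply/h/in_imfset.
Qed.

(** After exchanging the sums, a word w contributes the signed count of the A with n - Des(w) inside
    A, inside S, which is 1 if n - Des(w) = S and 0 otherwise. *)
Lemma beta_PiB (S : {fset nat}) : S `<=` interval1 n.-1 ->
  beta (PiB n) S =
  (count (fun w => Des w == [fset (n - x)%N | x in S]) (Bmset n))%:Z.
Proof.
move=> hS; rewrite /beta.
transitivity (\sum_(w <- Bmset n) \sum_(A <- fpowerset S)
    (-1) ^+ #|` S `\` A| * (Des_compl w `<=` A)%:R : int).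
  rewrite exchange_big; apply: eq_bigr => A _.
  rewrite alpha_PiB -big_distrr /=; congr (_ * _).
  by rewrite -natz natr_count.
under eq_bigr => w _ do rewrite sum_fpowerset_sign.
rewrite -natr_count natz; congr (Posz _); apply: eq_in_count => w /Bmset_shape[sw _].
apply: eq_subn_imfset => //; apply/fsubsetP => i /Des_range.
by rewrite sw !inE mem_iota; lia.
Qed.

Lemma horner_chain_poly d (L : finPOrderType d) (F : fieldType) (y : F) :
  (map_poly intr (chain_poly L)).[y] = \sum_(C : {set L} | is_chain C) y ^+ #|C|.
Proof.
rewrite /chain_poly poly_def rmorph_sum horner_sum /=.
rewrite (partition_big (fun C : {set L} => inord #|C| : 'I_#|L|.+1) xpredT) //=.
apply: eq_bigr => k _; rewrite linearZ /= map_polyXn hornerZ hornerXn.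
rewrite -pmulrn /nb_chains -sum1_card natr_sum big_distrl /=.
have cE (C : {set L}) : (inord #|C| == k) = (#|C| == k).
  by rewrite -val_eqE /= inordK // ltnS max_card.
apply: eq_big => [C|C]; first by rewrite inE cE.
by rewrite inE => /andP[_ /eqP ->]; rewrite mul1r.
Qed.

(** Sort the chains by their set K of coranks and exchange sums: with y = x/(1 - x), a word with d
    descents contributes (1 - x)^(n+1) times the sum of y^|K| over K containing Des(w), that is (1 -
    x)^(n+1) y^d (y + 1)^(n+1-d) = x^d. *)
Lemma h_poly_PiB :
  h_poly (PiB n) = FracField.tofrac (\sum_(w <- Bmset n) 'X^(des w)).
Proof.
rewrite /h_poly; set x := FracField.tofrac 'X.
have u_neq0 : 1 - x != 0.
  rewrite -(rmorph1 (@FracField.tofrac _)) -rmorphB /= tofrac_eq0.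
  by rewrite -size_poly_eq0 -opprB size_polyN size_XsubC.
set y := x / (1 - x).
have yx : y * (1 - x) = x by rewrite divfK.
have y1x : (y + 1) * (1 - x) = 1 by rewrite mulrDl yx mul1r addrC subrK.
rewrite rmorph_sum horner_chain_poly (@max_chain_card_corank _ _ corank); first last.
- exact: corank_cover.
- exact: corank_top.
- exact: corank_anti.
rewrite (partition_big (fun C : {set PiB n} => corank_ord corank @: C) xpredT) //=.
transitivity ((1 - x) ^+ (corank bot).+1 *
    \sum_(K : {set 'I_(corank bot).+1})
      \sum_(w <- Bmset n) (descents_in (fun i => inord i \in K) w)%:R * y ^+ #|K|).
  congr (_ * _); apply: eq_bigr => K _.
  rewrite -big_distrl -natr_count -card_chains_above_PiB -sum1_card natr_sum big_distrl /=.
  apply: eq_big => C.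
    rewrite inE [X in _ && (X && _)](_ : _ = true) //.
    by apply/forall_inP => t _; apply: le0x.
  move=> /andP[chC /eqP <-].
  by rewrite mul1r card_chain_coranks //; apply: corank_anti.
rewrite exchange_big big_distrr /=; apply: eq_big_seq => w /Bmset_shape[sw _].
pose D := [set k : 'I_(corank bot).+1 | (k : nat) \in Des w].
have DK (K : {set 'I_(corank bot).+1}) : descents_in (fun i => inord i \in K) w = (D \subset K).
  apply/descents_inP/subsetP => [h k|h i iw].
    by rewrite inE => /h; rewrite inord_val.
  by apply: h; rewrite inE inordK // corank_bottom; have := Des_range iw; rewrite sw; lia.
rewrite (eq_bigr (fun K : {set _} => (D \subset K)%:R * (y ^+ #|K| * 1 ^+ #|~: K|))); last first.
  by move=> K _; rewrite DK expr1n mulr1.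
rewrite sum_supersets; have cD : #|D| = des w.
  apply: card_ord_fset => i /Des_range; rewrite sw => hi.
  by rewrite corank_bottom; lia.
(* Splitting n + 1 this way pairs each factor y, and each factor y + 1, with one factor 1 - x. *)
rewrite [X in _ ^+ X * _](_ : _ = (#|D| + #|~: D|)%N); last by rewrite cardsC card_ord.
rewrite exprD mulrACA -!exprMn ![(1 - x) * _]mulrC yx y1x expr1n mulr1 cD.
by rewrite rmorphXn.
Qed.
End Conclusion.

Theorem proposition4p4 (n : nat) (hn : (1 <= n)%N) :
  (forall S : {fset nat}, S `<=` interval1 n.-1 ->
     beta (PiB n) S =
       (count (fun w => Des w == [fset (n - x)%N | x in S]) (Bmset n))%:Z)
  /\ h_poly (PiB n) = FracField.tofrac (\sum_(w <- Bmset n) 'X^(des w)).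
Proof. by split; [exact: beta_PiB | exact: h_poly_PiB]. Qed.
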